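(* Let $0<\underline{a}<\overline{a}$ and $\overline{p}>0$. For $(a,p)\in[\underline{a},\overline{a}]\times(0,\infty)$ let $(\lambda_1(a,p),\lambda_2(a,p))$ be the unique minimizer of $$\min_{(\lambda_1,\lambda_2)\in\mathbb{R}_+^2}\Bigl\|p\,\varphi_a-\lambda_1\,\overline{p}\,\varphi_{\overline{a}}-\lambda_2\,\overline{p}\,\varphi_{\underline{a}}\Bigr\|_{L^2(\mathbb{R})}^2 .$$ Then knowledge of the pair $(\lambda_1(a,p),\lambda_2(a,p))$ uniquely determines $(a,p)\in[\underline{a},\overline{a}]\times(0,\infty)$; that is, the map $(a,p)\mapsto(\lambda_1(a,p),\lambda_2(a,p))$ is injective on $[\underline{a},\overline{a}]\times(0,\infty)$.
   Context: $\mathbb{R}_+=[0,\infty)$. For $u>0$, $\varphi_u:\mathbb{R}\to\mathbb{R}$ is defined by $\varphi_u(r)=\sqrt{1-r^2/u^2}$ if $|r|\le u$ and $\varphi_u(r)=0$ otherwise. The quantities $\underline{a},\overline{a},\overline{p}$ are fixed and known. *)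

(* Defs.v *)
From HB Require Import structures.
From mathcomp Require Import all_boot all_order all_algebra.
From mathcomp Require Import all_classical all_reals all_analysis.
Set Implicit Arguments.
Unset Strict Implicit.
Unset Printing Implicit Defensive.
Import Order.TTheory GRing.Theory Num.Theory.
Import numFieldNormedType.Exports.
Local Open Scope classical_set_scope.
Local Open Scope ring_scope.

Definition phi (R : realType) (u r : R) : R :=
  if `|r| <= u then Num.sqrt (1 - r ^+ 2 / u ^+ 2) else 0.

(* Throughout, au and ao are the lower and upper endpoints of the range of the
   width a, and po is the fixed reference amplitude. *)
Definition residual (R : realType) (au ao po a p : R) (l : R * R) (r : R) : R :=
  p * phi a r - l.1 * po * phi ao r - l.2 * po * phi au r.

Definition objective (R : realType) (au ao po a p : R) (l : R * R) : \bar R :=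
  ('N[@lebesgue_measure R]_(2%:E)[EFin \o residual au ao po a p l] ^+ 2)%E.

Definition quadrant (R : realType) : set (R * R) :=
  [set l : R * R | 0 <= l.1 /\ 0 <= l.2].

Definition minimizers (R : realType) (au ao po a p : R) : set (R * R) :=
  [set l : R * R | quadrant l /\
    forall m, quadrant m ->
      (objective au ao po a p l <= objective au ao po a p m)%E].

(* [get] picks an element of the set of minimizers, and an arbitrary default if
   it is empty; the value is canonical only if that set is a singleton. *)
Definition lambda (R : realType) (au ao po : R) (ap : R * R) : R * R :=
  get (minimizers au ao po ap.1 ap.2).

Definition domain (R : realType) (au ao : R) : set (R * R) :=
  [set ap : R * R | au <= ap.1 <= ao /\ 0 < ap.2].

(* Main.v *)
(* The kernel G(a,b) = \int phi_a phi_b is strictly totally positive of order 2: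
   its 2 x 2 minors are, by Andreief's identity, double integrals of products of
   minors of (u,r) |-> phi_u(r), which all have the same sign because
   phi_b/phi_a increases with |r| for a < b. By Cramer's rule this makes the
   solution of the normal equations nonnegative, so the constraint is inactive
   and lambda is the unconstrained projection. Hence lambda determines
   p G(a,ao) and p G(a,au), whose ratio is strictly increasing in a. *)
Require Import Defs.
From mathcomp Require Import all_boot all_order all_algebra.
From mathcomp Require Import all_classical all_reals all_analysis.
From mathcomp Require Import measurable_realfun ring lra.
Import Order.TTheory GRing.Theory Num.Theory.
Import numFieldNormedType.Exports.
Local Open Scope classical_set_scope.
Local Open Scope ring_scope.

(** * Linearity, positivity and a minor inequality for integrals *)

Section integrals.
Context {R : realType}.
Implicit Types f g h k : R -> R.
Notation mu := (@lebesgue_measure R).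
Notation itg f := (mu.-integrable setT (EFin \o f)).

Lemma integrable_lin (c d : R) f g : itg f -> itg g ->
  itg (fun x => c * f x + d * g x).
Proof.
move=> fi gi.
exact (integrableD measurableT (integrableZl measurableT c fi)
                               (integrableZl measurableT d gi)).
Qed.

Lemma Rintegral_lin (c d : R) f g : itg f -> itg g ->
  \int[mu]_x (c * f x + d * g x) = c * \int[mu]_x f x + d * \int[mu]_x g x.
Proof.
move=> fi gi; rewrite RintegralD ?RintegralZl //.
- exact (integrableZl measurableT c fi).
- exact (integrableZl measurableT d gi).
Qed.

(** By continuity [f] exceeds [f x0 / 2] on a ball around [x0], and that ball has positive
    measure. *)
Lemma Rintegral_gt0 f x0 : continuous f -> itg f -> (forall x, 0 <= f x) ->
  0 < f x0 -> 0 < \int[mu]_x f x.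
Proof.
move=> fc fi f0 fx0.
have hx0 : f x0 / 2 < f x0 by rewrite ltr_pdivrMr// ltr_pMr// ltr1n.
have : \forall x \near x0, f x0 / 2 < f x by exact: cvgr_gt (fc x0) _ hx0.
move=> /nbhs_ballP[e /= e0 he].
rewrite /Rintegral -lte_fin fineK; last exact: integrable_fin_num.
have mf := measurable_int _ fi.
have mb : 'measurable (ball x0 e : set R) by exact: measurable_ball.
apply: (@lt_le_trans _ _ (\int[mu]_(x in ball x0 e) (cst (f x0 / 2)%:E x))%E).
  rewrite integral_cst// mule_gt0 ?lte_fin ?divr_gt0//.
  rewrite -[ltRHS]/(mu (ball x0 e)) (lebesgue_measure_ball _ (ltW e0)).
  by rewrite lte_fin mulrn_wgt0.
apply: (@le_trans _ _ (\int[mu]_(x in ball x0 e) (EFin \o f) x)%E).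
  apply: ge0_le_integral => //.
  - by move=> x _; rewrite lee_fin divr_ge0 ?ltW.
  - exact: measurable_funS mf.
  - by move=> x bx; rewrite lee_fin ltW//; exact: he.
apply: ge0_subset_integral => //= x _.
by rewrite lee_fin.
Qed.

(* Integrating [K x y] in y and then in x gives twice the difference of the two
   sides; no Fubini theorem is needed, as [K] is a sum of four product terms. *)
Lemma Rintegral_minor_lt f g h k x0 y0 :
  continuous (f \* h) /\ itg (f \* h) -> continuous (f \* k) /\ itg (f \* k) ->
  continuous (g \* h) /\ itg (g \* h) -> continuous (g \* k) /\ itg (g \* k) ->
  let K x y := (f x * g y - g x * f y) * (h x * k y - k x * h y) in
  (forall x y, 0 <= K x y) -> 0 < K x0 y0 ->
  \int[mu]_x (f x * k x) * \int[mu]_x (g x * h x) <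
  \int[mu]_x (f x * h x) * \int[mu]_x (g x * k x).
Proof.
move=> [fhc fhi] [fkc fki] [ghc ghi] [gkc gki] K K0 Kpos.
(* Both [K x] and its integral over [y], as a function of [x], have this form; the factors 1 fit the
   shape of [integrable_lin]. *)
pose comb (A B C D : R) x := 1 * (A * (f x * h x) + B * (f x * k x)) +
   1 * (C * (g x * h x) + D * (g x * k x)).
have combi A B C D : itg (comb A B C D).
  by apply: integrable_lin; apply: integrable_lin.
have combc A B C D : continuous (comb A B C D).
  move=> x; apply: cvgD; apply: cvgMr; apply: cvgD; apply: cvgMr.
  - exact: fhc.
  - exact: fkc.
  - exact: ghc.
  - exact: gkc.
have combE A B C D : \int[mu]_x comb A B C D x =
  A * \int[mu]_x (f x * h x) + B * \int[mu]_x (f x * k x) +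
  C * \int[mu]_x (g x * h x) + D * \int[mu]_x (g x * k x).
  rewrite Rintegral_lin; [|exact: integrable_lin..].
  by rewrite !Rintegral_lin// !mul1r addrA.
have KE x : K x = comb (g x * k x) (- (g x * h x)) (- (f x * k x)) (f x * h x).
  by apply/funext => y; rewrite /K /comb; ring.
pose F := comb (\int[mu]_y (g y * k y)) (- \int[mu]_y (g y * h y))
               (- \int[mu]_y (f y * k y)) (\int[mu]_y (f y * h y)).
have FE x : F x = \int[mu]_y K x y.
  by rewrite KE combE /F /comb; ring.
(* Positivity is used twice: at [y0] for the inner integral [F x0], then at [x0] for the outer
   one. *)
have : 0 < \int[mu]_x F x.
  apply: (@Rintegral_gt0 _ x0) => [|| x |]; [exact: combc|exact: combi| |].
    by rewrite FE; apply: Rintegral_ge0 => y _; exact: K0.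
  rewrite FE; apply: (@Rintegral_gt0 _ y0) => //; rewrite KE.
    exact: combc.
  exact: combi.
rewrite combE => I; lra.
Qed.

End integrals.

(** * The profiles and their overlap kernel *)

Section profiles.
Context {R : realType}.
Implicit Types a b u o p x y : R.
Notation mu := (@lebesgue_measure R).
Notation itg f := (mu.-integrable setT (EFin \o f)).

(* [Num.sqrt] vanishes on negative numbers. *)
Lemma phiE u x : 0 < u -> phi u x = Num.sqrt (1 - x ^+ 2 / u ^+ 2).
Proof.
move=> u0; rewrite /phi; case: ifPn => //; rewrite -ltNge => ux.
apply/esym/eqP; rewrite sqrtr_eq0 subr_le0 ler_pdivlMr ?exprn_gt0// mul1r.
by rewrite -(real_normK (num_real x)) lerXn2r ?nnegrE ?(ltW ux)// ltW.
Qed.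

Lemma phi_ge0 u x : 0 <= phi u x.
Proof. by rewrite /phi; case: ifP => // _; exact: sqrtr_ge0. Qed.

Lemma phi_le1 u x : 0 < u -> phi u x <= 1.
Proof.
move=> u0; rewrite phiE// -[leRHS]sqrtr1 ler_sqrt// gerBl.
by rewrite divr_ge0 ?sqr_ge0.
Qed.

Lemma phi0 u : 0 < u -> phi u 0 = 1.
Proof. by move=> u0; rewrite phiE// expr0n mul0r subr0 sqrtr1. Qed.

Lemma phi_continuous u : 0 < u -> continuous (phi u).
Proof.
move=> u0; rewrite (_ : phi u = Num.sqrt \o (fun x => 1 - x ^+ 2 / u ^+ 2)).
  move=> x; apply: continuous_comp; last exact: sqrt_continuous.
  apply: cvgB; first exact: cvg_cst.
  by apply: cvgMl; exact: exprn_continuous.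
by apply/funext => x /=; rewrite phiE.
Qed.

Lemma phiM_continuous a b : 0 < a -> 0 < b -> continuous (phi a \* phi b).
Proof. by move=> a0 b0 x; apply: cvgM; exact: phi_continuous. Qed.

Lemma phiM_integrable a b : 0 < a -> 0 < b -> itg (phi a \* phi b).
Proof.
move=> a0 b0.
(* The product is dominated by the indicator of [[-a, a]]. *)
apply: (le_integrable _ _ _ (integrable_indic_itv (- a) a true false)) => //.
  apply/measurable_EFinP; apply: continuous_measurable_fun.
  exact: phiM_continuous.
move=> x _ /=; rewrite lee_fin indicE !ger0_norm ?mulr_ge0 ?phi_ge0//.
have [xa|xa] := leP `|x| a; last first.
  by rewrite {1}/phi ifF ?mul0r//; apply/negbTE; rewrite -ltNge.
by rewrite mem_set ?mulr_ile1 ?phi_ge0 ?phi_le1//= in_itv/= -ler_norml.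
Qed.

(** Monotonicity of [phi b / phi a] in the absolute value, cross-multiplied to allow zeros. With X,
    Y the squares of [x], [y] and A, B the inverse squares of [a], [b], the squared sides differ by
    (Y - X)(A - B). *)
Lemma phi_minor_le a b x y : 0 < a -> a <= b -> `|x| <= `|y| ->
  phi b x * phi a y <= phi a x * phi b y.
Proof.
move=> a0 ab xy; have b0 : 0 < b by exact: lt_le_trans ab.
have XY : x ^+ 2 <= y ^+ 2.
  by rewrite -(real_normK (num_real x)) -(real_normK (num_real y)) lerXn2r ?nnegrE.
(* Either [phi a y] vanishes, and so does the left side, or its radicand is positive, which makes
   the other three nonnegative. *)
rewrite !phiE//; have [ya|ya] := leP (1 - y ^+ 2 / a ^+ 2) 0.
  by rewrite (eqP (_ : Num.sqrt (1 - y ^+ 2 / a ^+ 2) == 0)) ?sqrtr_eq0// mulr0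
             mulr_ge0 ?sqrtr_ge0.
have ba : (b ^+ 2)^-1 <= (a ^+ 2)^-1.
  by rewrite lef_pV2 ?posrE ?exprn_gt0// lerXn2r ?nnegrE ?(ltW a0) ?(ltW b0).
have a'0 : 0 < (a ^+ 2)^-1 by rewrite invr_gt0 exprn_gt0.
have b'0 : 0 < (b ^+ 2)^-1 by rewrite invr_gt0 exprn_gt0.
move: (x ^+ 2) (y ^+ 2) (sqr_ge0 x) (sqr_ge0 y) XY ya => X Y X0 Y0 XY ya.
move: (a ^+ 2)^-1 (b ^+ 2)^-1 ba a'0 b'0 ya => A B BA A0 B0 YA.
have XA : 0 <= 1 - X * A by rewrite (le_trans (ltW YA))// lerB// ler_wpM2r// ltW.
have YB : 0 <= 1 - Y * B by rewrite (le_trans (ltW YA))// lerB// ler_wpM2l.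
have XB : 0 <= 1 - X * B by rewrite (le_trans YB)// lerB// ler_wpM2r// ltW.
rewrite -!sqrtrM// ler_sqrt ?mulr_ge0// -subr_ge0.
rewrite (_ : _ - _ = (Y - X) * (A - B)); last by ring.
by rewrite mulr_ge0 ?subr_ge0.
Qed.

Lemma phi_lt a b x : 0 < a -> a < b -> x != 0 -> `|x| < b -> phi a x < phi b x.
Proof.
move=> a0 ab x0 xb; have b0 := lt_trans a0 ab.
rewrite !phiE// ltr_sqrt; last first.
  rewrite subr_gt0 ltr_pdivrMr ?exprn_gt0// mul1r -(real_normK (num_real x)).
  by rewrite ltrXn2r ?nnegrE ?(ltW b0).
rewrite ler_ltB// ltr_pM2l ?exprn_even_gt0// ltf_pV2 ?posrE ?exprn_gt0//.
by rewrite ltrXn2r ?nnegrE ?(ltW a0) ?(ltW b0).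
Qed.

(** The kernel G: the inner product of two profiles in L^2. *)
Definition overlap a b := \int[mu]_x (phi a x * phi b x).

Lemma overlapC a b : overlap a b = overlap b a.
Proof. by apply: eq_Rintegral => x _; rewrite mulrC. Qed.

Lemma overlap_gt0 a b : 0 < a -> 0 < b -> 0 < overlap a b.
Proof.
move=> a0 b0; apply: (@Rintegral_gt0 _ _ 0).
- exact: phiM_continuous.
- exact: phiM_integrable.
- by move=> x; rewrite mulr_ge0 ?phi_ge0.
- by rewrite !phi0// mul1r.
Qed.

(** Equivalently, [overlap b o / overlap b u] strictly increases with [b]. The weak inequalities at
    the ends let one lemma give the Gram determinant, both Cramer numerators and injectivity. *)
Lemma overlap_minor_lt u a b o : 0 < u -> u <= a -> a < b -> b <= o ->
  u < o -> overlap a o * overlap b u < overlap a u * overlap b o.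
Proof.
move=> u0 ua ab bo uo.
have a0 := lt_le_trans u0 ua; have b0 := lt_trans a0 ab.
have o0 := lt_le_trans b0 bo.
(* At 0 all profiles equal 1, so the minors reduce to differences of profiles at [u / 2], where both
   are positive. *)
apply: (@Rintegral_minor_lt _ _ _ _ _ 0 (u / 2)).
- by split; [exact: phiM_continuous|exact: phiM_integrable].
- by split; [exact: phiM_continuous|exact: phiM_integrable].
- by split; [exact: phiM_continuous|exact: phiM_integrable].
- by split; [exact: phiM_continuous|exact: phiM_integrable].
- move=> x y; have [xy|/ltW yx] := leP `|x| `|y|.
    by rewrite mulr_ge0// subr_ge0 phi_minor_le// ltW.
  by rewrite mulr_le0// subr_le0 mulrC [leRHS]mulrC phi_minor_le// ltW.
- have h0 : 0 < u / 2 by rewrite divr_gt0.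
  have hu : u / 2 < u by lra.
  rewrite !phi0// !mul1r mulr_gt0// subr_gt0 phi_lt ?gt_eqF// gtr0_norm//; lra.
Qed.

End profiles.

(** * Algebra of two-variable least squares *)

(** Links the square in [objective] to the real exponent in [poweR_Lnorm]. *)
Lemma expe2_poweR (R : realType) (z : \bar R) :
  (0 <= z -> z ^+ 2 = z `^ 2)%E.
Proof.
case: z => [r| |]//; last by rewrite poweRyr// expe2 mulyy.
by rewrite lee_fin => r0; rewrite poweR_EFin powR_mulrn.
Qed.

Lemma posdef_form_gt0 (R : realFieldType) (A B C d e : R) :
  0 < A -> B ^+ 2 < A * C -> (d, e) != (0, 0) ->
  0 < A * d ^+ 2 + 2 * B * d * e + C * e ^+ 2.
Proof.
move=> A0 D0 de0; rewrite -(pmulr_rgt0 _ A0).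
(* Completing the square. *)
rewrite [ltRHS](_ : _ = (A * d + B * e) ^+ 2 + (A * C - B ^+ 2) * e ^+ 2); last by ring.
have [e0|e0] := eqVneq e 0.
  move: de0; rewrite e0 xpair_eqE eqxx andbT => d0.
  by rewrite !mulr0 expr0n mulr0 !addr0 exprn_even_gt0// mulf_neq0// gt_eqF.
by rewrite ltr_wpDl ?sqr_ge0// mulr_gt0 ?subr_gt0// exprn_even_gt0.
Qed.

(** The normal equations cancel the linear part, so [q m - q l] is the positive definite form at
    [m - l]. *)
Lemma least_squares_lt (R : realFieldType) (A B C E U V p : R) (l m : R * R) :
  0 < A -> B ^+ 2 < A * C ->
  p * U = l.1 * A + l.2 * B -> p * V = l.1 * B + l.2 * C -> m != l ->
  let q n := p ^+ 2 * E + n.1 ^+ 2 * A + n.2 ^+ 2 * C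
    - 2 * p * n.1 * U - 2 * p * n.2 * V + 2 * n.1 * n.2 * B in
  q l < q m.
Proof.
case: l m => [l1 l2] [m1 m2] /= A0 D0 E1 E2 ml; rewrite -subr_gt0.
have := posdef_form_gt0 _ _ _ _ (m1 - l1) (m2 - l2) A0 D0.
rewrite xpair_eqE !subr_eq0 -xpair_eqE => /(_ ml).
congr (_ < _); apply/esym.
transitivity (m1 ^+ 2 * A + m2 ^+ 2 * C + 2 * m1 * m2 * B
  - (l1 ^+ 2 * A + l2 ^+ 2 * C + 2 * l1 * l2 * B)
  - 2 * (m1 - l1) * (p * U) - 2 * (m2 - l2) * (p * V)); first ring.
by rewrite E1 E2; ring.
Qed.

Lemma cramer2_ge0 (R : realFieldType) (A B C u v : R) : B ^+ 2 < A * C ->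
  0 <= C * u - B * v -> 0 <= A * v - B * u ->
  exists l : R * R, [/\ 0 <= l.1, 0 <= l.2,
    u = l.1 * A + l.2 * B & v = l.1 * B + l.2 * C].
Proof.
rewrite -subr_gt0 => D0 N1 N2.
exists ((C * u - B * v) / (A * C - B ^+ 2), (A * v - B * u) / (A * C - B ^+ 2)).
by split; rewrite /= ?divr_ge0 ?(ltW D0)//; field; rewrite gt_eqF.
Qed.

(** * The objective and its unique minimizer *)

Section objective.
Context {R : realType} (au ao po : R).
Context (au0 : 0 < au) (auo : au < ao) (po0 : 0 < po).
Notation mu := (@lebesgue_measure R).
Notation G := overlap.
Notation itg f := (mu.-integrable setT (EFin \o f)).
Let ao0 : 0 < ao := lt_trans au0 auo.

Lemma objectiveE (a p : R) (l : R * R) : 0 < a ->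
  objective au ao po a p l =
  (p ^+ 2 * G a a + (l.1 * po) ^+ 2 * G ao ao + (l.2 * po) ^+ 2 * G au au
   - 2 * p * (l.1 * po) * G a ao - 2 * p * (l.2 * po) * G a au
   + 2 * (l.1 * po) * (l.2 * po) * G ao au)%:E.
Proof.
move=> a0; have i (b c : R) (b0 : 0 < b) (c0 : 0 < c) := phiM_integrable _ _ b0 c0.
(* The expanded squared residual, nested as binary combinations for [Rintegral_lin]. *)
pose q x := 1 * (1 * (p ^+ 2 * (phi a x * phi a x)
     + (l.1 * po) ^+ 2 * (phi ao x * phi ao x))
   + 1 * ((l.2 * po) ^+ 2 * (phi au x * phi au x)
     + (- 2 * p * (l.1 * po)) * (phi a x * phi ao x)))
   + 1 * ((- 2 * p * (l.2 * po)) * (phi a x * phi au x)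
     + (2 * (l.1 * po) * (l.2 * po)) * (phi ao x * phi au x)).
have qE x : q x = residual au ao po a p l x ^+ 2 by rewrite /q /residual; ring.
have qi : itg q by do 3?[apply: integrable_lin]; exact: i.
have -> : objective au ao po a p l = (\int[mu]_x (q x)%:E)%E.
  rewrite /objective expe2_poweR ?Lnorm_ge0// poweR_Lnorm//.
  apply: eq_integral => x _.
  by rewrite /comp abse_EFin poweR_EFin powR_mulrn// real_normK ?num_real// qE.
rewrite -[LHS]fineK ?integrable_fin_num//; congr EFin.
rewrite -[LHS]/(\int[mu]_x q x) /q.
rewrite !Rintegral_lin /overlap; do ?[exact: i|apply: integrable_lin].
rewrite -!/(overlap _ _).
move: (G a a) (G ao ao) (G au au) (G a ao) (G a au) (G ao au) => *; ring.
Qed.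

Lemma minimizersE (a p : R) : domain au ao (a, p) ->
  exists l : R * R,
    [/\ minimizers au ao po a p = [set l],
        p * G a ao = l.1 * po * G ao ao + l.2 * po * G ao au &
        p * G a au = l.1 * po * G ao au + l.2 * po * G au au].
Proof.
move=> [/andP[/= aua aao] p0]; have a0 := lt_le_trans au0 aua.
have D0 : G ao au ^+ 2 < G ao ao * G au au.
  have := overlap_minor_lt _ _ _ _ au0 (lexx au) auo (lexx ao) auo.
  by rewrite (overlapC au ao) expr2 [in ltRHS]mulrC.
(* At [a = au] the two terms coincide; otherwise this is a strict minor. [N2] is similar at [ao]. *)
have N1 : 0 <= G au au * G a ao - G ao au * G a au.
  have [->|auna] := eqVneq a au; first by rewrite (overlapC au ao) mulrC subrr.
  have aula : au < a by rewrite lt_neqAle eq_sym auna.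
  rewrite subr_ge0 -(overlapC au ao) ltW//.
  exact: overlap_minor_lt au0 (lexx au) aula aao auo.
have N2 : 0 <= G ao ao * G a au - G ao au * G a ao.
  have [->|anao] := eqVneq a ao; first by rewrite mulrC subrr.
  have alao : a < ao by rewrite lt_neqAle anao.
  rewrite subr_ge0 mulrC [leRHS]mulrC ltW//.
  exact: overlap_minor_lt au0 aua alao (lexx ao) auo.
(* Solved first for the amplitudes already multiplied by [po]; [l'] then removes this factor. *)
have [l [l1 l2 E1 E2]] : exists l : R * R, [/\ 0 <= l.1, 0 <= l.2,
    p * G a ao = l.1 * G ao ao + l.2 * G ao au &
    p * G a au = l.1 * G ao au + l.2 * G au au].
  apply: cramer2_ge0 => //; rewrite (mulrCA _ p) [X in _ - X](mulrCA _ p) -mulrBr.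
    by rewrite mulr_ge0// ltW.
  by rewrite mulr_ge0// ltW.
have pon0 : po != 0 by rewrite gt_eqF.
pose l' := (l.1 / po, l.2 / po).
have l'1 : l'.1 * po = l.1 by rewrite divfK.
have l'2 : l'.2 * po = l.2 by rewrite divfK.
(* Here [m] ranges over the whole plane: [l'] is the unconstrained minimizer. *)
have lt m : m != l' -> (objective au ao po a p l' < objective au ao po a p m)%E.
  move=> ml; rewrite !objectiveE// lte_fin l'1 l'2.
  have {}ml : (m.1 * po, m.2 * po) != l.
    apply: contra ml => /eqP ml; apply/eqP.
    by rewrite /l' -ml /= !mulfK// -surjective_pairing.
  exact: (least_squares_lt _ _ _ _ (G a a) _ _ _ _ _ (overlap_gt0 _ _ ao0 ao0)
           D0 E1 E2 ml).
have l'q : quadrant l' by split; rewrite divr_ge0 ?(ltW po0).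
exists l'; rewrite l'1 l'2; split => //.
apply/seteqP; split => m /=.
  move=> [mq mle]; apply/eqP; apply: contraT => /lt.
  by rewrite ltNge mle.
move=> ->; split=> // n _; have [->//|/lt/ltW//] := eqVneq n l'.
Qed.

(** The minimizers form a singleton, so [get] returns its element and not the default. *)
Lemma lambdaE (a p : R) : domain au ao (a, p) ->
  [/\ minimizers au ao po a p = [set lambda au ao po (a, p)],
      p * G a ao = (lambda au ao po (a, p)).1 * po * G ao ao
                   + (lambda au ao po (a, p)).2 * po * G ao au &
      p * G a au = (lambda au ao po (a, p)).1 * po * G ao au
                   + (lambda au ao po (a, p)).2 * po * G au au].
Proof.
move=> /minimizersE[l [ml E1 E2]].
suff -> : lambda au ao po (a, p) = l by [].
by rewrite /lambda ml; apply: (@getPex _ [set l]); exists l.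
Qed.

End objective.

Theorem theorem2 (R : realType) (au ao po : R)
    (hau : 0 < au) (hao : au < ao) (hpo : 0 < po) :
  (forall ap : R * R, domain au ao ap ->
     minimizers au ao po ap.1 ap.2 = [set lambda au ao po ap]) /\
  set_inj (domain au ao) (lambda au ao po).
Proof.
split=> [[a p] ap|]; first by have [] := lambdaE _ _ _ hau hao hpo _ _ ap.
have not_lt (a b p q : R) : domain au ao (a, p) -> domain au ao (b, q) ->
    lambda au ao po (a, p) = lambda au ao po (b, q) -> ~ a < b.
  move=> dap dbq e ab.
  have [_ E1 E2] := lambdaE _ _ _ hau hao hpo _ _ dap.
  have [_ F1 F2] := lambdaE _ _ _ hau hao hpo _ _ dbq.
  rewrite e -F1 in E1; rewrite e -F2 in E2.
  case: dap dbq => /= /andP[aua _] p0 [/= /andP[_ bo] q0].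
  (* Now [p G(a,.) = q G(b,.)] at both [ao] and [au], so multiplying the strict minor by [p * q]
     makes its two sides equal. *)
  have := overlap_minor_lt _ _ _ _ hau aua ab bo hao.
  rewrite -(ltr_pM2l (mulr_gt0 p0 q0)) (mulrACA p q) E1 -E2.
  by rewrite (mulrC (q * _)) (mulrACA p _ q) ltxx.
move=> [a p] [b q]; rewrite !inE => dap dbq e.
have ab : a = b.
  have [ab|ba|//] := ltgtP a b.
    by have := not_lt _ _ _ _ dap dbq e ab.
  by have := not_lt _ _ _ _ dbq dap (esym e) ba.
subst b; have [_ E1 _] := lambdaE _ _ _ hau hao hpo _ _ dap.
have [_ F1 _] := lambdaE _ _ _ hau hao hpo _ _ dbq.
(* With equal widths, cancelling the positive overlap with [ao] leaves equal amplitudes. *)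
rewrite e -F1 in E1; congr pair; move: E1; apply: mulIf.
case: dap => /= /andP[aua _] _.
rewrite gt_eqF//; apply: overlap_gt0; first exact: lt_le_trans aua.
exact: lt_trans hao.
Qed.
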